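(* A collection $\mathcal C$ of languages is generatable in the limit with feedback if there exists a countable set of collections $\mathcal C_1,\mathcal C_2,\dots$ such that $\mathcal C=\bigcup_{i}\mathcal C_i$ and each $\mathcal C_i$ is uniformly generatable.
   Context: A language is an infinite subset of a countably infinite universe $U$; a collection is a set of languages. An enumeration of $K$ is an infinite sequence $x_0,x_1,\dots$ of pairwise distinct elements of $K$ containing every element of $K$; $S_t=\{x_0,\dots,x_t\}$. A collection $\mathcal D$ is uniformly generatable if there is a function $G$ from finite sequences in $U$ to $U$ and a time $t^\star$ such that for every $K\in\mathcal D$, every enumeration of $K$, and every $t\ge t^\star$, $G(x_0,\dots,x_t)\in K\setminus S_t$. Generation with feedback: at each time $t$ the adversary reveals $x_t$, the algorithm asks a membership query $y_t=G(x_0,a_0,\dots,a_{t-1},x_t)\in U$, receives $a_t\in\{\mathrm{Yes},\mathrm{No}\}$ indicating whether $y_t\in K$, and outputs $z_t=G(x_0,a_0,\dots,x_t,a_t)$; $\mathcal C$ is generatable in the limit with feedback if some such $G$ satisfies: for every $K\in\mathcal C$ and every enumeration of $K$ there is $t^\star$ with $z_t\in K\setminus S_t$ for all $t\ge t^\star$. *)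

(* Defs.v *)
From HB Require Import structures.
From mathcomp Require Import all_boot.
From mathcomp Require Import boolp classical_sets functions cardinality.

Set Implicit Arguments.
Unset Strict Implicit.
Unset Printing Implicit Defensive.

Local Open Scope classical_set_scope.

Definition language {U : Type} (K : set U) : Prop := infinite_set K.

Definition collection {U : Type} (C : set (set U)) : Prop :=
  forall K, C K -> language K.

Definition enumeration {U : Type} (K : set U) (x : nat -> U) : Prop :=
  injective x /\ range x = K.

(* S_t = {x_0, ..., x_t}: both endpoints are included. *)
Definition revealed {U : Type} (x : nat -> U) (t : nat) : set U :=
  [set x i | i in [set i | (i <= t)%N]].

Definition uniformly_generatable {U : Type} (D : set (set U)) : Prop :=
  exists (G : seq U -> U) (tstar : nat),
    forall K, D K -> forall x, enumeration K x ->
    forall t, (tstar <= t)%N -> (K `\` revealed x t) (G (mkseq x t.+1)).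

(* A history x_0, a_0, x_1, a_1, ... is a list over U + bool: inl x_t is an
   element revealed by the adversary, inr a_t an answer (true = Yes). The same
   function G asks queries and produces outputs; the parity of the length of
   the history tells the two uses apart.
   [history G K x t] is x_0, a_0, ..., x_(t-1), a_(t-1). *)
Fixpoint history {U : Type} (G : seq (U + bool) -> U) (K : set U)
    (x : nat -> U) (t : nat) : seq (U + bool) :=
  if t is s.+1 then
    let h := rcons (history G K x s) (inl (x s)) in
    rcons h (inr `[< K (G h) >])
  else [::].

(* The query y_t is G (rcons (history G K x t) (inl (x t))), inside [history];
   the output z_t is computed after the answer a_t. *)
Definition feedback_output {U : Type} (G : seq (U + bool) -> U) (K : set U)
    (x : nat -> U) (t : nat) : U := G (history G K x t.+1).

Definition generatable_with_feedback {U : Type} (C : set (set U)) : Prop :=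
  exists G : seq (U + bool) -> U,
    forall K, C K -> forall x, enumeration K x ->
    exists tstar : nat, forall t, (tstar <= t)%N ->
      (K `\` revealed x t) (feedback_output G K x t).

(* Main.v *)
(** Every index [n] carries a candidate uniform generator, with its threshold.
    Query the proposal of the current candidate; once past its threshold, drop
    the candidate for the next one as soon as a proposal is answered No or was
    already revealed. A candidate that is correct for [K] is never dropped, so
    the current index is bounded, hence eventually constant; from then on every
    proposal past the threshold is a new element of [K], and it serves both as
    query and as output. *)
Require Import Defs.
From mathcomp Require Import all_boot.
From mathcomp Require Import boolp classical_sets functions cardinality.

Local Open Scope classical_set_scope.

Definition generates {U : Type} (D : set (set U)) (g : seq U -> U) (t0 : nat) :=
  forall K, D K -> forall x, enumeration K x ->
  forall t, (t0 <= t)%N -> (K `\` revealed x t) (g (mkseq x t.+1)).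

(** Membership is decided classically, as [U] has no equality test; the default [y] of [nth] is
    never reached since [k] is in range. *)
Definition occurs {U : Type} (y : U) (s : seq U) : bool :=
  `[< exists2 k, (k < size s)%N & nth y s k = y >].

Lemma occurs_mkseq (U : Type) (y : U) (x : nat -> U) (t : nat) :
  occurs y (mkseq x t.+1) <-> revealed x t y.
Proof.
split=> [/asboolP[k]|[k kt xk]].
  by rewrite size_mkseq => kt; rewrite nth_mkseq // => <-; exists k.
by apply/asboolP; exists k; rewrite ?size_mkseq ?nth_mkseq.
Qed.

Section Elimination.
Context {U : Type} (gen : nat -> seq U -> U) (thr : nat -> nat).

(** Once [x t] is revealed, [size s] is [t.+1], so the strict inequality means [thr i <= t]. *)
Definition rejected (i : nat) (s : seq U) (a : bool) : bool :=
  (thr i < size s)%N && (~~ a || occurs (gen i s) s).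

Definition update (st : nat * seq U) (e : U + bool) : nat * seq U :=
  match e with
  | inl u => (st.1, rcons st.2 u)
  | inr a => (st.1 + rejected st.1 st.2 a, st.2)%N
  end.

Definition state (h : seq (U + bool)) : nat * seq U := foldl update (0, [::]) h.

Lemma state_rcons h e : state (rcons h e) = update (state h) e.
Proof. exact: foldl_rcons. Qed.

(** An answer leaves the revealed sequence unchanged, so query and output at one time can differ
    only if the answer advances the index. *)
Definition propose (h : seq (U + bool)) : U := gen (state h).1 (state h).2.

Context (K : set U) (x : nat -> U).

Definition candidate (t : nat) : nat := (state (history propose K x t)).1.

Lemma state_history t :
  state (history propose K x t) = (candidate t, mkseq x t).
Proof.
rewrite [LHS]surjective_pairing; congr pair; elim: t => //= t IHt.
by rewrite !state_rcons /= IHt mkseqS.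
Qed.

Lemma state_reveal t :
  state (rcons (history propose K x t) (inl (x t))) =
  (candidate t, mkseq x t.+1).
Proof. by rewrite state_rcons state_history mkseqS. Qed.

Lemma candidateS t :
  candidate t.+1 = (candidate t +
    rejected (candidate t) (mkseq x t.+1)
      `[< K (gen (candidate t) (mkseq x t.+1)) >])%N.
Proof.
by rewrite {1}/candidate /= state_rcons state_reveal /= {1}/propose state_reveal.
Qed.

Lemma rejectedP i t : (thr i <= t)%N ->
  ~~ rejected i (mkseq x t.+1) `[< K (gen i (mkseq x t.+1)) >] <->
  (K `\` revealed x t) (gen i (mkseq x t.+1)).
Proof.
move=> it; rewrite /rejected size_mkseq ltnS it /= negb_or negbK.
split=> [/andP[/asboolP Ky /negP ny]|[Ky ny]].
  by split=> // /occurs_mkseq.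
by apply/andP; split; [apply/asboolP | apply/negP => /occurs_mkseq].
Qed.

Lemma candidate_homo : {homo candidate : s t / (s <= t)%N}.
Proof.
by apply: homo_leq => // [? ? ?|t]; [exact: leq_trans | rewrite candidateS leq_addr].
Qed.

(** The index grows by at most one per step, so it cannot skip [j]; at [j] no rejection occurs,
    before [thr j] by definition and afterwards by assumption. *)
Lemma candidate_bounded j :
  (forall t, (thr j <= t)%N -> (K `\` revealed x t) (gen j (mkseq x t.+1))) ->
  forall t, (candidate t <= j)%N.
Proof.
move=> genj; elim=> // t; rewrite candidateS leq_eqVlt => /predU1P[->|ltj].
  case jt: (thr j <= t)%N; last by rewrite /rejected size_mkseq ltnS jt addn0.
  by have /(rejectedP _ _ jt)/negbTE -> := genj _ jt; rewrite addn0.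
by apply: leq_trans ltj; rewrite -[(candidate t).+1]addn1 leq_add2l leq_b1.
Qed.

Lemma propose_in_the_limit j :
  (forall t, (thr j <= t)%N -> (K `\` revealed x t) (gen j (mkseq x t.+1))) ->
  exists t0, forall t, (t0 <= t)%N ->
    (K `\` revealed x t) (feedback_output propose K x t).
Proof.
move=> /candidate_bounded bj.
(* [t0] will be a time at which the largest index ever attained is in use. *)
pose P n := `[< exists t, candidate t = n >].
have exP : exists n, P n by exists (candidate 0); apply/asboolP; exists 0%N.
have ubP n : P n -> (n <= j)%N by move=> /asboolP[t <-].
have [n /asboolP[t0 <-] maxP] := ex_maxnP exP ubP.
have const t : (t0 <= t)%N -> candidate t = candidate t0.
  move=> t0t; apply/eqP; rewrite eqn_leq (candidate_homo _ _ t0t) andbT.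
  by apply: maxP; apply/asboolP; exists t.
exists (maxn t0 (thr (candidate t0))) => t; rewrite geq_max => /andP[t0t thrt].
(* The output at [t] uses [candidate t.+1], already updated by the answer, so constancy is needed at
   [t.+1]. *)
rewrite /feedback_output /propose state_history const ?(leqW t0t) //=.
apply/rejectedP => //.
(* Equal indices at [t] and [t.+1] force the rejection bit to be zero. *)
have /eqP := candidateS t; rewrite !const ?(leqW t0t) //.
by rewrite -[X in X == _]addn0 eqn_add2l eq_sym eqb0.
Qed.

End Elimination.

Theorem theorem6p1 (U : Type) (U_countably_infinite : ([set: U] #= [set: nat])%card)
    (C : set (set U)) (C_collection : collection C) :
  (exists F : set (set (set U)),
     [/\ countable F,
         forall D, F D -> collection D,
         C = \bigcup_(D in F) D
       & forall D, F D -> uniformly_generatable D]) ->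
  generatable_with_feedback C.
Proof.
move=> [F [/countable_injP[f injf] _ -> unifF]].
have /card_set_bijP[e [_ _ /(_ 0%N I)[u _ _]]] := U_countably_infinite.
(* Injectivity of [f] on [F] leaves at most one collection per index; an index coding none gets the
   constant [u], for which the condition is vacuous. *)
have /choice[gt gtP] n : exists gt : (seq U -> U) * nat,
    forall D, F D -> f D = n -> generates D gt.1 gt.2.
  have [[D [FD fD]]|noD] := pselect (exists D, F D /\ f D = n).
    have [g [t0 gD]] := unifF D FD; exists (g, t0) => D' FD' fD'.
    suff -> : D' = D by [].
    by apply: injf; rewrite ?inE // fD' fD.
  by exists (fun=> u, 0%N) => D FD fD; case: noD; exists D.
exists (propose (fun n => (gt n).1) (fun n => (gt n).2)) => K [D FD DK] x xK.
apply: (@propose_in_the_limit _ _ _ _ _ (f D)) => t.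
exact: (gtP _ D FD erefl K DK x xK).
Qed.
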